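(* Let $G$ be a topological group. Then $G$ is almost free if and only if $G$ is almost countably free.
   Context: Topological groups are not assumed to be Hausdorff. For a cardinal $\kappa>0$ and a group $G$, let $G_\kappa$ denote the set of $\kappa$-tuples $(g_i)_{i\in\kappa}\in G^\kappa$ that freely generate a free subgroup of $G$, i.e. such that no nontrivial reduced group word in the indexed variables $(x_i)_{i\in\kappa}$ evaluates to $1$ at $(g_i)_{i\in\kappa}$ (equivalently, the homomorphism from the free group on $\{x_i\}_{i\in\kappa}$ to $G$ sending $x_i\mapsto g_i$ is injective). An infinite topological group $G$ is called almost $\kappa$-free if $G_\kappa$ is dense in $G^\kappa$ with the product topology (a finite topological group is not almost $\kappa$-free). $G$ is called almost free if it is almost $n$-free for every positive integer $n$. ''Almost countably free'' means almost $\aleph_0$-free. *)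

(* Defs.v *)
From HB Require Import structures.
From mathcomp Require Import all_boot.
From mathcomp Require Import classical_sets cardinality.
From mathcomp Require Import topology.

Set Implicit Arguments.
Unset Strict Implicit.
Unset Printing Implicit Defensive.

Local Open Scope classical_set_scope.
Local Open Scope group_scope.

(* [Group] is the class of arbitrary, possibly infinite, groups, and no
   separation axiom is imposed on the topology. *)
HB.mixin Record isTopologicalGroup G & Topological G & Group G := {
  mulg_continuous : continuous (fun x : G * G => x.1 * x.2) ;
  invg_continuous : continuous (fun x : G => x^-1)
}.

#[short(type="topologicalGroupType")]
HB.structure Definition TopologicalGroup :=
  {G of Topological G & Group G & isTopologicalGroup G}.

(* The letter (i, true) stands for x_i and (i, false) for its inverse. *)
Definition group_word (I : eqType) := seq (I * bool).

Definition inverse_letters (I : eqType) (a b : I * bool) : bool :=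
  (a.1 == b.1) && (a.2 != b.2).

Definition reduced (I : eqType) (w : group_word I) : bool :=
  sorted (fun a b => ~~ inverse_letters a b) w.

Definition eval_word (I : eqType) (G : groupType) (g : I -> G)
    (w : group_word I) : G :=
  \prod_(a <- w) (if a.2 then g a.1 else (g a.1)^-1).

(* G_kappa, for kappa the cardinality of I *)
Definition free_tuples (I : eqType) (G : groupType) : set (I -> G) :=
  [set g | forall w : group_word I, reduced w -> w != [::] ->
             eval_word g w <> 1].

(* [{ptws I -> G}] is G^I with the product topology. *)
Definition almost_free_on (I : eqType) (G : topologicalGroupType) : Prop :=
  infinite_set [set: G] /\ dense (@free_tuples I G : set {ptws I -> G}).

Definition almost_free (G : topologicalGroupType) : Prop :=
  forall n : nat, (0 < n)%N -> almost_free_on 'I_n G.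

Definition almost_countably_free (G : topologicalGroupType) : Prop :=
  almost_free_on nat G.

(* Main.v *)
Require Import Defs.
From mathcomp Require Import all_boot.
From mathcomp Require Import classical_sets cardinality filter.
From mathcomp Require Import topology.

Set Implicit Arguments.
Unset Strict Implicit.
Unset Printing Implicit Defensive.

Local Open Scope classical_set_scope.
Local Open Scope group_scope.

(** From a free tuple (x_0, ..., x_(n-1), a, b) one gets the infinite free tuple
  x_0, ..., x_(n-1), a^n b a^-n, a^(n+1) b a^-(n+1), ...
  with the same first n entries.  A neighbourhood in G^nat constrains only
  finitely many coordinates, so density of free (n+2)-tuples for all n gives
  density of infinite free tuples.  Conversely, a finite tuple extends to a
  sequence, and any part of a free tuple is free. *)

Section Words.
Context {G : groupType}.

Lemma eval_word_cat (I : eqType) (g : I -> G) (v w : group_word I) :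
  eval_word g (v ++ w) = eval_word g v * eval_word g w.
Proof. by rewrite /eval_word big_cat. Qed.

Lemma eval_word_cons (I : eqType) (g : I -> G) (l : I * bool)
    (w : group_word I) :
  eval_word g (l :: w) =
    (if l.2 then g l.1 else (g l.1)^-1) * eval_word g w.
Proof. by rewrite /eval_word big_cons. Qed.

Lemma eval_word_nseq (I : eqType) (g : I -> G) (l : I * bool) (k : nat) :
  eval_word g (nseq k l) = (if l.2 then g l.1 else (g l.1)^-1) ^+ k.
Proof.
elim: k => [|k IHk]; first by rewrite /eval_word big_nil.
by rewrite /= eval_word_cons IHk expgS.
Qed.

(** An injective renaming of variables keeps a word reduced, so a relation among the selected
    entries would be a relation of [g]. *)
Lemma free_tuples_comp (I J : eqType) (f : J -> I) (g : I -> G) :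
  injective f -> free_tuples g -> free_tuples (g \o f).
Proof.
move=> f_inj g_free w w_red w_nil.
have <- : eval_word g [seq (f l.1, l.2) | l <- w] = eval_word (g \o f) w.
  by rewrite /eval_word big_map.
apply: g_free; last by case: w w_nil {w_red}.
rewrite /reduced sorted_map; apply: sub_sorted w_red => l m /=.
by rewrite /inverse_letters /= (inj_eq f_inj).
Qed.

End Words.

Section Conjugates.
Variables (I J : eqType) (a : I) (core : J -> I) (shift : J -> nat).

(** The reduced form of [a^-s a^t], which arises between consecutive conjugates. *)
Definition power_word (s t : nat) : group_word I :=
  if s <= t then nseq (t - s) (a, true) else nseq (s - t) (a, false).

(* Rewriting each letter j of w as a^(shift j) (core j) a^-(shift j), merging
  adjacent powers of a, and removing an initial a^s. *)
Fixpoint conjugate_word (s : nat) (w : group_word J) : group_word I :=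
  if w is l :: w' then
    power_word s (shift l.1) ++ (core l.1, l.2) :: conjugate_word (shift l.1) w'
  else power_word s 0.

Lemma eval_power_word (G : groupType) (g : I -> G) (s t : nat) :
  g a ^+ s * eval_word g (power_word s t) = g a ^+ t.
Proof.
rewrite /power_word; case: leqP => st; rewrite eval_word_nseq /=.
  by rewrite -expgnDr subnKC.
by rewrite expVgn -{1}(subnKC (ltnW st)) expgnDr mulgK.
Qed.

(** The factor [g a ^+ s] restores the removed prefix, so the induction telescopes: after a letter
    of index [j], the pending power is [shift j]. *)
Lemma eval_conjugate_word (G : groupType) (g : I -> G) (s : nat)
    (w : group_word J) :
  g a ^+ s * eval_word g (conjugate_word s w) =
  eval_word (fun j => g a ^+ shift j * g (core j) * (g a ^+ shift j)^-1) w.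
Proof.
elim: w s => [|[j e] w IHw] s /=.
  by rewrite eval_power_word /eval_word big_nil.
rewrite eval_word_cat mulgA eval_power_word !eval_word_cons -(IHw (shift j)) /=.
by case: e; rewrite ?invgM ?invgK !mulgA mulgVK.
Qed.

Hypothesis core_neq : forall j, core j != a.
Hypothesis core_shift_inj : injective (fun j => (core j, shift j)).

Let compat (K : eqType) (l m : K * bool) := ~~ inverse_letters l m.

(** A nonempty power repeats one letter, which cancels neither itself, nor [c], nor the head of [v];
    thus [c] meets [v] only when the power is empty, that is, when [s = t]. *)
Lemma path_power_word (c : I * bool) (s t : nat) (v : group_word I) :
  c.1 != a ->
  (forall e, path (@compat I) (a, e) v) ->
  (s = t -> path (@compat I) c v) ->
  path (@compat I) c (power_word s t ++ v).
Proof.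
move=> ca av cv.
have pow k e : path (@compat I) (a, e) (nseq k (a, e) ++ v).
  elim: k => [|k IHk] //=.
  by rewrite IHk /compat /inverse_letters /= !eqxx.
have pow1 k e : path (@compat I) c (nseq k.+1 (a, e) ++ v).
  by rewrite /= pow /compat /inverse_letters /= (negPf ca).
rewrite /power_word; case: leqP => [|st].
  rewrite leq_eqVlt => /orP[/eqP st|st]; first by rewrite -st subnn; apply: cv.
  by rewrite -(subnSK st).
by rewrite -(subnSK st).
Qed.

(** Two neighbouring core letters can cancel only if their shifts and cores agree; they then come
    from the same index with opposite signs, a cancellation already in [w]. *)
Lemma path_conjugate_word (l : J * bool) (w : group_word J) :
  path (@compat J) l w ->
  path (@compat I) (core l.1, l.2) (conjugate_word (shift l.1) w).
Proof.
elim: w l => [|m w IHw] l /=.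
  by move=> _; rewrite -[power_word _ _]cats0; apply: path_power_word => /=.
case/andP=> lm /IHw mw; apply: path_power_word => //= [e|st].
  by rewrite mw andbT /compat /inverse_letters /= eq_sym (negPf (core_neq _)).
rewrite mw andbT /compat /inverse_letters /=.
apply: contra lm => /andP[/eqP ce ne]; rewrite /inverse_letters ne andbT.
by apply/eqP/core_shift_inj; rewrite ce st.
Qed.

Lemma reduced_conjugate_word (w : group_word J) :
  reduced w -> reduced (conjugate_word 0 w).
Proof.
case: w => [|l w] //= /path_conjugate_word lw.
rewrite /reduced /power_word leq0n subn0.
move: (conjugate_word _ w) lw => v; case: (shift l.1) => [|k] //= lv.
elim: k => [|k IHk] /=.
  by rewrite lv andbT /inverse_letters /= eq_sym (negPf (core_neq _)).
by rewrite IHk /inverse_letters /= !eqxx.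
Qed.

Lemma free_tuples_conjugates (G : groupType) (g : I -> G) :
  free_tuples g ->
  free_tuples (fun j => g a ^+ shift j * g (core j) * (g a ^+ shift j)^-1).
Proof.
move=> g_free w w_red w_nil.
rewrite -(eval_conjugate_word g 0) mul1g.
apply: g_free; first exact: reduced_conjugate_word.
(* Each letter of [w] contributes a core letter, so the new word is nonempty. *)
by case: w w_nil {w_red} => //= l w _; case: power_word.
Qed.

End Conjugates.

Lemma cvg_ptws (I : Type) (V : topologicalType) (F : set_system {ptws I -> V})
    (f : {ptws I -> V}) :
  Filter F -> (forall i, (fun g : {ptws I -> V} => g i) @ F --> f i) ->
  F --> f.
Proof.
move=> FF Ff; apply/cvg_sup => i U.
have /= -> := @nbhsE (initial_topology (fun g : {ptws I -> V} => g i)) f.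
case=> B [[C oC <-] Cf] /filterS; apply.
by apply: Ff; apply: open_nbhs_nbhs.
Qed.

Lemma continuous_ptws (I : Type) (T V : topologicalType)
    (h : T -> {ptws I -> V}) :
  (forall i, continuous (fun x => h x i)) -> continuous h.
Proof.
by move=> hc x; apply: cvg_ptws => i; apply: hc.
Qed.

Lemma nbhs_ptws_nat (V : topologicalType) (f : {ptws nat -> V})
    (A : set (nat -> V)) :
  nbhs f A -> exists n,
    nbhs f [set h | forall g, (forall i, (i < n)%N -> g i = h i) -> A g].
Proof.
(* The filter [F] converges to [f] coordinatewise, hence in the product. *)
pose F : set_system {ptws nat -> V} := [set B | exists n,
  nbhs f [set h | forall g, (forall i, (i < n)%N -> g i = h i) -> B g]].
suff : F --> f by apply.
have ff : Filter (nbhs f) := nbhs_filter f.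
have FF : Filter F.
  split.
  - by exists 0; apply: filterE => h g _.
  - move=> B C [m Bm] [n Cn]; exists (maxn m n).
    apply: filterS2 Bm Cn => h Bh Ch g gh.
    by split; [apply: Bh|apply: Ch] => i lti; apply: gh;
      rewrite leq_max lti ?orbT.
  - move=> B C BC [n Bn]; exists n.
    by apply: filterS Bn => h Bh g /Bh /BC.
apply: cvg_ptws => i U Uf; exists i.+1.
have Uif : nbhs f [set h | U (h i)].
  exact: (@proj_continuous _ (fun=> V) i f U Uf).
apply: filterS Uif => h Uh g gh.
by rewrite /= gh.
Qed.

Lemma dense_free_nat (G : topologicalGroupType) :
  (forall n, dense (@free_tuples 'I_n.+2 G : set {ptws 'I_n.+2 -> G})) ->
  dense (@free_tuples nat G : set {ptws nat -> G}).
Proof.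
move=> dG O [f Of] oO.
have [n fn] : exists n, nbhs f
    [set h | forall g, (forall i, (i < n)%N -> g i = h i) -> O g].
  by apply/nbhs_ptws_nat/open_nbhs_nbhs.
(* [e] varies the first [n] entries of [f] and keeps its tail. [e x] need not be free, but it lies
   near [f] when [x] lies near [x0], and the free sequence built below agrees with it on the first
   [n] entries. *)
pose e (x : {ptws 'I_n.+2 -> G}) : {ptws nat -> G} :=
  fun i => if (i < n)%N then x (inord i) else f i.
have ec : continuous e.
  apply: continuous_ptws => i; rewrite /e; case: (i < n)%N.
    exact: (@proj_continuous _ (fun=> G) (inord i)).
  exact: cst_continuous.
pose x0 : {ptws 'I_n.+2 -> G} := fun k => f k.
have ex0 : e x0 = f.
  apply: boolp.funext => i; rewrite /e /x0; case: ifP => // lti.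
  by rewrite inordK // ltnS ltnW // ltnS ltnW.
rewrite -ex0 in fn; have := ec _ _ fn; rewrite nbhsE => -[B [oB Bx0] Be].
have [x [Bx xfree]] := dG n B (ex_intro _ _ Bx0) oB.
(* Entries below [n] are kept, with shift 0; for [i >= n] the entry is [b] conjugated by [a^i],
   where [a] and [b] sit at positions [n] and [n.+1] of [x]. *)
pose core i : 'I_n.+2 := if (i < n)%N then inord i else ord_max.
pose shift i := if (i < n)%N then 0 else i.
pose a : 'I_n.+2 := inord n.
have a_val : a = n :> nat by rewrite inordK.
have core_val i : core i = (if (i < n)%N then i else n.+1) :> nat.
  by rewrite /core; case: ifP => // lti; rewrite inordK // ltnS ltnW // ltnS ltnW.
exists (fun i => x a ^+ shift i * x (core i) * (x a ^+ shift i)^-1); split.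
  apply: (Be x Bx) => i lti.
  by rewrite /e /core /shift lti mul1g invg1 mulg1.
apply: (free_tuples_conjugates _ _ xfree) => [i|i j [/(congr1 val) /=]].
  rewrite -val_eqE /= core_val a_val; case: ifP => [lti|_].
    by rewrite ltn_eqF.
  by rewrite gtn_eqF.
(* Cores separate the kept entries from each other and from [b]; shifts separate the conjugates of
   [b]. *)
rewrite !core_val /shift; case: ifP => [lti|_]; case: ifP => [ltj|_] //.
  by move=> ij; move: lti; rewrite ij ltnNge leqnSn.
by move=> ij; move: ltj; rewrite -ij ltnNge leqnSn.
Qed.

Lemma dense_free_ord (G : topologicalGroupType) (n : nat) :
  dense (@free_tuples nat G : set {ptws nat -> G}) ->
  dense (@free_tuples 'I_n G : set {ptws 'I_n -> G}).
Proof.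
move=> dG O [f Of] oO.
pose r (g : {ptws nat -> G}) : {ptws 'I_n -> G} := fun k => g k.
have rc : continuous r.
  by apply: continuous_ptws => k; exact: (@proj_continuous _ (fun=> G) (val k)).
(* [f0] only shows that the preimage of [O] is nonempty; the value 1 past [n] is arbitrary. *)
pose f0 : {ptws nat -> G} := fun i => if insub i is Some k then f k else 1.
have rf0 : r f0 = f by apply: boolp.funext => k; rewrite /r /f0 valK.
have [|g [Og gfree]] := dG (r @^-1` O) _ (open_comp (fun g _ => rc g) oO).
  by exists f0; rewrite /= rf0.
by exists (r g); split=> //; apply: free_tuples_comp gfree; apply: val_inj.
Qed.

Theorem proposition7 (G : topologicalGroupType) :
  almost_free G <-> almost_countably_free G.
Proof.
split=> [aG|[Ginf dG] n n_gt0].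
  split; first by have [] := aG 1%N isT.
  by apply: dense_free_nat => n; have [] := aG n.+2 isT.
by split=> //; apply: dense_free_ord.
Qed.
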